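(* The sequence $(x_n^{(3)})$ satisfies $x_1^{(3)}=3$, $x_2^{(3)}=6$, and $x_{2n-1}^{(3)}=2x_{n-1}^{(3)}+1$ for all $n\geq2$, $x_{2n}^{(3)}=2x_n^{(3)}$ for all $n\geq1$.
   Context: For a positive integer $m$, let $\nu_2(m)$ be the exponent of the highest power of $2$ dividing $m$. Define $x_1^{(3)}=3$ and, for $n\ge2$, $x_n^{(3)}$ is the smallest integer $y>x_{n-1}^{(3)}$ with $\nu_2(y)=\nu_2(n)$. *)

(* Defs.v *)
From mathcomp Require Import all_boot.

Set Implicit Arguments.
Unset Strict Implicit.
Unset Printing Implicit Defensive.

Definition nu2 (m : nat) : nat := logn 2 m.

Lemma next_nu2_exists (n x : nat) : exists y, (x < y) && (nu2 y == nu2 n).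
Proof.
exists (2 ^ nu2 n * (x.*2).+1); apply/andP; split.
  apply: (@leq_trans (x.*2).+1); first by rewrite ltnS -addnn leq_addr.
  by rewrite leq_pmull // expn_gt0.
rewrite /nu2 lognM ?expn_gt0 // pfactorK //.
by rewrite [logn 2 _.+1]lognE dvdn2 /= odd_double addn0.
Qed.

Definition next_nu2 (n x : nat) : nat := ex_minn (next_nu2_exists n x).

(* [x3 n] is x_n^(3) for n >= 1; the value at 0 is a dummy. *)
Fixpoint x3 (n : nat) : nat :=
  match n with
  | 0 => 0
  | 1 => 3
  | (_.+1 as k).+1 => next_nu2 k.+1 (x3 k)
  end.

(* Main.v *)
Require Import Defs.
From mathcomp Require Import all_boot.

(** Once [x3 (2 * n) = 2 * x3 n] is known, the next term has odd index, hence is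
    the next odd number [2 * x3 n + 1]; the term after it is the least even
    [2 * z > 2 * x3 n + 1] with [nu2 z = nu2 n.+1], i.e. [z = x3 n.+1]. *)

Lemma nu2_double n : 0 < n -> nu2 n.*2 = (nu2 n).+1.
Proof. by move=> n_gt0; rewrite /nu2 -mul2n lognM. Qed.

Lemma nu2_eq0 n : 0 < n -> (nu2 n == 0) = odd n.
Proof.
move=> n_gt0; rewrite /nu2 lognE n_gt0 dvdn2 /=.
by case: (odd n).
Qed.

Lemma next_nu2P n x y :
    x < y -> nu2 y = nu2 n -> (forall z, x < z -> nu2 z = nu2 n -> y <= z) ->
  next_nu2 n x = y.
Proof.
move=> lt_xy nu_y min_y; rewrite /next_nu2.
case: ex_minnP => m /andP[lt_xm /eqP nu_m] min_m.
by apply/eqP; rewrite eqn_leq min_m ?lt_xy ?nu_y ?eqxx //= min_y.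
Qed.

(** Odd [n] asks for valuation 0, which the odd number [x.+1] already has. *)
Lemma next_nu2_odd n x : odd n -> ~~ odd x -> next_nu2 n x = x.+1.
Proof.
move=> odd_n even_x; apply: next_nu2P => //.
have /eqP-> : nu2 x.+1 == 0 by rewrite nu2_eq0.
by apply/esym/eqP; rewrite nu2_eq0 // odd_gt0.
Qed.

(** Valuation [(nu2 n).+1] forces a candidate to be even, and halving turns the candidates above
    [x.*2.+1] into those for [n] above [x]. *)
Lemma next_nu2_double n x :
  0 < n -> next_nu2 n.*2 x.*2.+1 = (next_nu2 n x).*2.
Proof.
move=> n_gt0; rewrite {2}/next_nu2.
case: ex_minnP => m /andP[lt_xm /eqP nu_m] min_m.
have m_gt0 : 0 < m by apply: leq_ltn_trans lt_xm.
apply: next_nu2P => [||z lt_xz].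
- by rewrite -doubleS leq_double in lt_xm *.
- by rewrite !nu2_double ?nu_m.
have z_gt0 : 0 < z by apply: leq_ltn_trans lt_xz.
rewrite nu2_double // => nu_z.
have even_z : ~~ odd z by rewrite -nu2_eq0 // nu_z.
have def_z : z = z./2.*2 by rewrite even_halfK.
move: lt_xz nu_z z_gt0; rewrite def_z double_gt0 -doubleS leq_double => lt_xz.
move=> nu_z z2_gt0; rewrite nu2_double // in nu_z.
by rewrite leq_double min_m // lt_xz; case: nu_z => ->; rewrite eqxx.
Qed.

Lemma x3S n : 0 < n -> x3 n.+1 = next_nu2 n.+1 (x3 n).
Proof. by case: n. Qed.

Lemma x3_2 : x3 2 = 6.
(* Only 4 and 5 lie between 3 and 6; their valuations 2 and 0 differ from [nu2 2 = 1]. *)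
Proof. by apply: next_nu2P => // -[|[|[|[|[|[|z]]]]]]. Qed.

(** The value at [n.*2] is assumed so that the induction proving [x3_double] can supply it. *)
Lemma x3_doubleS n : 0 < n -> x3 n.*2 = (x3 n).*2 -> x3 n.*2.+1 = (x3 n).*2.+1.
Proof.
move=> n_gt0 x3n2; rewrite x3S ?double_gt0 // x3n2.
by rewrite next_nu2_odd /= ?odd_double.
Qed.

Lemma x3_double n : 0 < n -> x3 n.*2 = (x3 n).*2.
Proof.
(* The effective base is index 1, as [x3 1] does not arise from the dummy [x3 0]. *)
elim: n => // -[_ _|n IHn _]; first exact: x3_2.
by rewrite doubleS x3S // x3_doubleS ?IHn // -doubleS next_nu2_double // -x3S.
Qed.

Theorem theorem4 :
  [/\ x3 1 = 3,
      x3 2 = 6,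
      (forall n : nat, 2 <= n -> x3 (2 * n - 1) = 2 * x3 (n - 1) + 1)
    & (forall n : nat, 1 <= n -> x3 (2 * n) = 2 * x3 n)].
Proof.
split=> [||[|[|n]] // _|n n_gt0]; first by [].
- exact: x3_2.
(* With the index written [n.+2], the left side is [x3] at [n.+1.*2.+1]. *)
- by rewrite !mul2n !subn1 addn1 doubleS !succnK x3_doubleS ?x3_double.
- by rewrite !mul2n x3_double.
Qed.
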